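(* The map $(\Lambda, M, C, * ) \mapsto (\Lambda, 1, M, C, * )$, given by assigning the trivial group to each $\lambda \in \Lambda$, carries a cell datum (on an associative unital $R$-algebra $A$) to a naive-cellular datum (on $A$), and identifies cellular algebras with those naive-cellular algebras for which each group $G(\lambda)$ is the trivial group.
   Context: $R$ is a commutative ring with unit. A cellular algebra (Graham–Lehrer) over $R$ is an associative unital $R$-algebra $A$ with cell datum $(\Lambda,M,C,* )$, where: (C1) $\Lambda$ is a poset and, for each $\lambda\in\Lambda$, $M(\lambda)$ is a finite set such that $\coprod_{\lambda} M(\lambda)\times M(\lambda)\to A$, $(S,T)\mapsto C_{S,T}^{\lambda}$, is injective with image an $R$-basis of $A$. (C2) $*$ is an $R$-linear anti-involution of $A$ with $(C_{S,T}^{\lambda})^*=C_{T,S}^{\lambda}$. (C3) For $\lambda\in\Lambda$, $S,T\in M(\lambda)$, $a\in A$: $aC_{S,T}^{\lambda}\equiv\sum_{S'\in M(\lambda)} r_a(S',S)C_{S',T}^{\lambda}\pmod{A(<\lambda)}$, where $r_a(S',S)\in R$ is independent of $T$ and $A(<\lambda)$ is the $R$-span of the $C_{U,V}^{\mu}$ with $\mu<\lambda$, $U,V\in M(\mu)$. A naive-cellular algebra over $R$ is an associative unital $R$-algebra $A$ together with a naive-cellular datum $(\Lambda,G,M,C,* )$, where: (W1) $\Lambda$ is a poset; for each $\lambda\in\Lambda$, $G(\lambda)$ is a group and $M(\lambda)$ is a finite set, such that the map $\coprod_{\lambda\in\Lambda} M(\lambda)\times G(\lambda)\times M(\lambda)\to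 A$, $(p,\sigma,q)\mapsto C_{p,q}^{\sigma}$, is injective with image an $R$-basis of $A$. (W2) $*$ is an $R$-linear anti-involution of $A$ with $(C_{p,q}^{\sigma})^*=C_{q,p}^{\sigma^{-1}}$. (W3) If $\sigma\in G(\lambda)$ and $p,q\in M(\lambda)$, then for any $a\in A$ we have $aC_{p,q}^{\sigma}\equiv\sum_{\sigma'\in G(\lambda),\,p'\in M(\lambda)} r_a(p',\sigma'\sigma^{-1},p)\,C_{p',q}^{\sigma'} \pmod{I_{<\lambda}}$, where $r_a(p',\sigma'\sigma^{-1},p)\in R$ depends only on $a,p',p$ and the product $\sigma'\sigma^{-1}$, and $I_{<\lambda}$ is the $R$-span of the $C_{p'',q''}^{\tau}$ with $\mu<\lambda$, $\tau\in G(\mu)$, $p'',q''\in M(\mu)$. In $(\Lambda,1,M,C,* )$, the symbol $1$ denotes the assignment of the trivial group to each $\lambda$, and $C$ is identified with $(p,1,q)\mapsto C_{p,q}^{\lambda}$ for $p,q\in M(\lambda)$. ''Identifies'' means that cell data correspond bijectively under this map to naive-cellular data with all groups trivial. *)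

(* Defs.v *)
From HB Require Import structures.
From mathcomp Require Import all_boot all_order all_algebra.
From mathcomp Require Import boolp classical_sets functions cardinality fsbigop.

Set Implicit Arguments.
Unset Strict Implicit.
Unset Printing Implicit Defensive.

Import GRing.Theory.
Local Open Scope classical_set_scope.
Local Open Scope ring_scope.

(* Associative unital algebras over R. The library's algType R requires        *)
(* 1 != 0; here the zero algebra (and the zero base ring) is allowed. Every    *)
(* algType over R yields an instance, see assocAlg_of_algType below.           *)
HB.mixin Record Lmodule_isAssocAlg (R : pzRingType) A of GRing.Lmodule R A := {
  aone : A;
  amul : A -> A -> A;
  amulA : associative amul;
  amul1l : left_id aone amul;
  amul1r : right_id aone amul;
  amulDl : left_distributive amul +%R;
  amulDr : right_distributive amul +%R;
  amulZl : forall (k : R) (x y : A), amul (k *: x) y = k *: amul x y;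
  amulZr : forall (k : R) (x y : A), amul x (k *: y) = k *: amul x y
}.

#[short(type="assocAlgType")]
HB.structure Definition AssocAlg (R : pzRingType) :=
  {A of Lmodule_isAssocAlg R A & GRing.Lmodule R A}.

Definition assocAlg_of_algType (R : pzRingType) (A : algType R) :
    Lmodule_isAssocAlg R A :=
  Lmodule_isAssocAlg.Build R A (@mulrA A) (@mul1r A) (@mulr1 A)
    (@mulrDl A) (@mulrDr A) (fun k x y => esym (scalerAl k x y))
    (fun k x y => esym (scalerAr k x y)).

Section LinearAlgebra.
Variables (R : comPzRingType) (V : lmodType R).

(* The sums below are over the (finite) support of the summand within S. *)
Definition lin_span (S : set V) : set V :=
  [set x | exists2 c : V -> R, finite_set [set y | c y != 0] &
             x = \sum_(y \in S) c y *: y].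

Definition lin_indep (S : set V) : Prop :=
  forall c : V -> R, finite_set [set y | c y != 0] ->
    \sum_(y \in S) c y *: y = 0 -> forall y, S y -> c y = 0.

Definition is_basis (S : set V) : Prop := lin_indep S /\ lin_span S = setT.

End LinearAlgebra.

Definition anti_involution (R : comPzRingType) (A : assocAlgType R)
    (s : A -> A) : Prop :=
  [/\ linear s, forall x y, s (amul x y) = amul (s y) (s x) & involutive s].

Record cell_data (R : comPzRingType) (A : assocAlgType R) (d : Order.disp_t) :=
  CellData {
    cell_poset : porderType d;
    cell_set : cell_poset -> finType;
    cell_elt : forall l, cell_set l -> cell_set l -> A;
    cell_star : A -> A
  }.

Record naive_data (R : comPzRingType) (A : assocAlgType R) (d : Order.disp_t) :=
  NaiveData {
    naive_poset : porderType d;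
    naive_group : naive_poset -> groupType;
    naive_set : naive_poset -> finType;
    naive_elt : forall l, naive_set l -> naive_group l -> naive_set l -> A;
    naive_star : A -> A
  }.

Section Data.
Variables (R : comPzRingType) (A : assocAlgType R) (d : Order.disp_t).

Section Cell.
Variable D : cell_data A d.
Local Notation M := (@cell_set _ _ _ D).
Local Notation C := (@cell_elt _ _ _ D _).

Definition cell_map (x : {l : cell_poset D & (M l * M l)%type}) : A :=
  C (tagged x).1 (tagged x).2.

Definition cell_lower (l : cell_poset D) : set A :=
  lin_span [set x | exists m : cell_poset D, (m < l)%O /\
                      exists U V : M m, x = C U V].

Record is_cell_datum : Prop := {
  cell_inj : injective cell_map;
  cell_basis : is_basis (range cell_map);
  cell_star_anti : anti_involution (cell_star D);
  cell_star_elt : forall l (S T : M l), cell_star D (C S T) = C T S;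
  cell_mul : forall l, exists r : A -> M l -> M l -> R,
    forall (a : A) (S T : M l),
      cell_lower l (amul a (C S T) - \sum_(S' : M l) r a S' S *: C S' T)
}.

End Cell.

Section Naive.
Variable N : naive_data A d.
Local Notation G := (@naive_group _ _ _ N).
Local Notation M := (@naive_set _ _ _ N).
Local Notation C := (@naive_elt _ _ _ N _).

Definition naive_map (x : {l : naive_poset N & (M l * G l * M l)%type}) : A :=
  C (tagged x).1.1 (tagged x).1.2 (tagged x).2.

Definition naive_lower (l : naive_poset N) : set A :=
  lin_span [set x | exists m : naive_poset N, (m < l)%O /\
                      exists (p : M m) (t : G m) (q : M m), x = C p t q].

(* G l may be infinite, so the sum in naive_mul only makes sense when all but  *)
(* finitely many of its coefficients vanish; this is part of the condition.    *)
Record is_naive_datum : Prop := {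
  naive_inj : injective naive_map;
  naive_basis : is_basis (range naive_map);
  naive_star_anti : anti_involution (naive_star N);
  naive_star_elt : forall l (p q : M l) (s : G l),
    naive_star N (C p s q) = C q s^-1%g p;
  naive_mul : forall l, exists r : A -> M l -> G l -> M l -> R,
    forall (a : A) (p : M l) (s : G l) (q : M l),
      finite_set [set x : M l * G l | r a x.1 (x.2 * s^-1)%g p != 0] /\
      naive_lower l (amul a (C p s q) -
        \sum_(x \in [set: (M l * G l)%type])
           r a x.1 (x.2 * s^-1)%g p *: C x.1 x.2 q)
}.

Definition trivial_groups : Prop := forall l (s : G l), s = 1%g.

End Naive.

End Data.

Definition trivial_group : Type := unit.
HB.instance Definition _ := Choice.on trivial_group.
HB.instance Definition _ := isGroup.Build trivial_group
  (one := tt) (inv := fun=> tt) (mul := fun _ _ => tt)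
  (fun _ _ _ => erefl) (fun x => let: tt := x in erefl)
  (fun x => let: tt := x in erefl) (fun=> erefl) (fun=> erefl).

Definition cell_to_naive (R : comPzRingType) (A : assocAlgType R)
    (d : Order.disp_t) (D : cell_data A d) : naive_data A d :=
  NaiveData (naive_group := fun=> trivial_group : groupType)
    (fun l p _ q => @cell_elt R A d D l p q) (cell_star D).

(* The two data differ only by relabelling each group along an isomorphism. *)
Variant naive_eq_upto_groups (R : comPzRingType) (A : assocAlgType R)
    (d : Order.disp_t) : naive_data A d -> naive_data A d -> Prop :=
  NaiveEqUptoGroups (L : porderType d) (G G' : L -> groupType)
      (M : L -> finType) (C : forall l, M l -> G l -> M l -> A)
      (C' : forall l, M l -> G' l -> M l -> A) (s : A -> A)
      (f : forall l, {multiplicative G l -> G' l}) of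
      (forall l, bijective (f l)) &
      (forall l p t q, C' l p (f l t) q = C l p t q) :
    naive_eq_upto_groups (NaiveData C s) (NaiveData C' s).

(* Main.v *)
Require Import Defs.
From HB Require Import structures.
From mathcomp Require Import all_boot all_order all_algebra.
From mathcomp Require Import boolp classical_sets functions cardinality fsbigop.

Set Implicit Arguments.
Unset Strict Implicit.
Unset Printing Implicit Defensive.

Import GRing.Theory.
Local Open Scope classical_set_scope.
Local Open Scope ring_scope.

(* Keeping only the elements C_{p,q}^1 sends a naive-cellular datum back to a  *)
(* cell datum. It is a left inverse of the map of the theorem, it depends only *)
(* on the datum up to isomorphism of the groups, and when all groups are       *)
(* trivial it preserves and reflects each axiom: the two families of basis     *)
(* elements, and hence the two ideals spanned by lower elements, coincide.     *)

Section NaiveToCell.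
Variables (R : comPzRingType) (A : assocAlgType R) (d : Order.disp_t).
Implicit Types (D : cell_data A d) (N : naive_data A d).

(** In a trivial group, [s'^-1] and [s' * s^-1] are always 1. So the star axioms agree, the
    coefficient of the naive multiplication rule depends only on [a], [p'] and [p], and its sum over
    pairs collapses to the finite sum over [M l]. This gives the equivalence
    [is_cell_datum_naive_to_cell]. The rest is formal: existence uses the naive-to-cell map, which
    inverts the other one exactly when the groups are [trivial_group] ([naive_to_cellK]) and up to
    isomorphism when they merely have one element; uniqueness uses [cell_to_naiveK], with invariance
    under isomorphism in the second case. *)

Definition naive_to_cell N : cell_data A d :=
  CellData (fun (l : naive_poset N) (p q : naive_set l) => naive_elt p 1%g q)
    (naive_star N).

Lemma cell_to_naiveK : cancel (@cell_to_naive R A d) naive_to_cell.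
Proof. by case. Qed.

Lemma naive_to_cellK N :
  naive_group (n := N) = (fun=> trivial_group : groupType) ->
  cell_to_naive (naive_to_cell N) = N.
Proof.
case: N => L G M C s /= eG; subst G; congr (NaiveData _ s).
do 2!apply: functional_extensionality_dep => ?.
by apply: functional_extensionality_dep => -[].
Qed.

Lemma naive_to_cell_eq_upto_groups N N' :
  naive_eq_upto_groups N N' -> naive_to_cell N = naive_to_cell N'.
Proof.
case=> L G G' M C C' s f _ fC; congr (CellData _ s).
do 3!apply: functional_extensionality_dep => ?; rewrite /= -fC.
(* The element [f 1] equals its own square, so it is 1 by cancellation. *)
by congr C'; apply: (@mulgI _ (f _ 1%g)); rewrite -gmulfM !mulg1.
Qed.

Lemma cell_to_naive_eq_upto_groups N : trivial_groups N ->
  naive_eq_upto_groups (cell_to_naive (naive_to_cell N)) N.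
Proof.
case: N => L G M C s /= G1.
(* The isomorphism is the constant map 1; its bijectivity and compatibility with [C] follow because
   [G l] has one element. *)
have f l : {multiplicative trivial_group -> G l} := @one_fun _ _.
apply: (@NaiveEqUptoGroups R A d L (fun=> trivial_group) G M _ C s f) => l;
  last by move=> p t q; rewrite (G1 _ (f l t)).
by exists (fun=> tt) => [[] //|g]; rewrite (G1 _ (f l tt)) [RHS]G1.
Qed.

Lemma trivial_groups_cell_to_naive D : trivial_groups (cell_to_naive D).
Proof. by move=> l []. Qed.

Section TrivialGroups.
Variable N : naive_data A d.
Hypothesis G1 : trivial_groups N.
Local Notation D := (naive_to_cell N).

Lemma range_naive_to_cell :
  range (cell_map (D := D)) = range (naive_map (N := N)).
Proof.
apply/seteqP; split=> [_ [[l [p q]] _ <-]|_ [[l [[p s] q]] _ <-]].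
  by exists (existT _ l (p, 1%g, q)).
by exists (existT _ l (p, q)) => //; rewrite /naive_map /= (G1 s).
Qed.

Lemma lower_naive_to_cell (l : naive_poset N) :
  cell_lower (D := D) l = naive_lower l.
Proof.
congr (lin_span _); apply/seteqP.
split=> [x [m [ml [p [q ->]]]]|x [m [ml [p [s [q ->]]]]]].
  by exists m; split=> //; exists p, 1%g, q.
by exists m; split=> //; exists p, q; rewrite (G1 s).
Qed.

Lemma inj_naive_to_cell :
  injective (cell_map (D := D)) <-> injective (naive_map (N := N)).
Proof.
split=> inj.
  move=> [l [[p s] q]] [l' [[p' s'] q']] e.
  have /inj : cell_map (D := D) (existT _ l (p, q)) =
               cell_map (D := D) (existT _ l' (p', q')).
    by move: e; rewrite /naive_map /= (G1 s) (G1 s').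
  rewrite (G1 s) (G1 s').
  (* Equal dependent pairs are not split into components, which would require transport along
     [l = l']; the equality is pushed forward by a map [h] between the index types. *)
  pose T (l : naive_poset N) : Type :=
    (naive_set l * naive_group l * naive_set l)%type.
  pose h (x : {l : naive_poset N & (naive_set l * naive_set l)%type}) :=
    existT T (tag x) ((tagged x).1, 1%g, (tagged x).2).
  by move=> /(congr1 h).
move=> [l [p q]] [l' [p' q']] e.
have /inj : naive_map (N := N) (existT _ l (p, 1%g, q)) =
             naive_map (existT _ l' (p', 1%g, q')).
  by [].
pose T (l : naive_poset N) : Type :=
  (naive_set l * naive_group l * naive_set l)%type.
pose h (x : {l : naive_poset N & T l}) :=
  existT (fun l : naive_poset N => naive_set l * naive_set l)%type
    (tag x) ((tagged x).1.1, (tagged x).2).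
by move=> /(congr1 h).
Qed.

Lemma finite_set_trivial_group (l : naive_poset N)
    (X : set (naive_set l * naive_group l)) :
  finite_set X.
Proof.
apply: (@sub_finite_set _ _ ((fun p => (p, 1%g)) @` setT)).
  by move=> [p s] _; exists p; rewrite // (G1 s).
exact/finite_image/finite_finset.
Qed.

(** Reindexing along the bijection sending [p] to [(p, 1)] turns the sum of the naive multiplication
    rule into that of the cell rule. *)
Lemma fsbig_trivial_group (l : naive_poset N)
    (F : naive_set l * naive_group l -> A) :
  \sum_(x \in setT) F x = \sum_(p : naive_set l) F (p, 1%g).
Proof.
rewrite (reindex_fsbig (fun p => (p, 1%g)) setT); last first.
  split=> // [p p' _ _ [] //|[p s] _].
  by exists p; rewrite // (G1 s).
rewrite (fsbigE (enum (naive_set l))) ?enum_uniq // => [|p _];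
  last by rewrite mem_enum.
by rewrite big_enum_cond; apply: eq_bigl => p; rewrite in_setT.
Qed.

Lemma is_cell_datum_naive_to_cell : is_cell_datum D <-> is_naive_datum N.
Proof.
split=> -[inj basis anti elt mul]; split.
- exact/inj_naive_to_cell.
- by rewrite -range_naive_to_cell.
- exact: anti.
- by move=> l p q s; rewrite [s^-1%g]G1 (G1 s); apply: elt.
- move=> l; have [r rP] := mul l; exists (fun a p' _ p => r a p' p) => a p s q.
  split; first exact: finite_set_trivial_group.
  rewrite fsbig_trivial_group -lower_naive_to_cell (G1 s).
  exact: rP.
- exact/inj_naive_to_cell.
- by rewrite range_naive_to_cell.
- exact: anti.
- by move=> l p q; rewrite /= elt invg1.
(* The naive rule is used at group element 1, where the only quotient occurring is
   [1 * 1^-1 = 1]. *)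
- move=> l; have [r rP] := mul l; exists (fun a p' p => r a p' 1%g p) => a p q.
  rewrite lower_naive_to_cell; have [_] := rP a p 1%g q.
  rewrite fsbig_trivial_group; under eq_bigr do rewrite /= invg1 mulg1.
  exact.
Qed.

End TrivialGroups.
End NaiveToCell.

Theorem proposition2p4 (R : comPzRingType) (A : assocAlgType R)
    (d : Order.disp_t) :
  (forall D : cell_data A d,
     is_cell_datum D -> is_naive_datum (cell_to_naive D)) /\
  (forall N : naive_data A d, is_naive_datum N ->
     naive_group (n := N) = (fun=> trivial_group : groupType) ->
     exists! D : cell_data A d, is_cell_datum D /\ cell_to_naive D = N) /\
  (forall N : naive_data A d, is_naive_datum N -> trivial_groups N ->
     exists! D : cell_data A d,
       is_cell_datum D /\ naive_eq_upto_groups (cell_to_naive D) N).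
Proof.
split=> [D cD|].
  (* The equivalence is applied to the image of [D], whose associated cell datum is [D] again. *)
  apply/(is_cell_datum_naive_to_cell (@trivial_groups_cell_to_naive _ _ _ D)).
  by rewrite cell_to_naiveK.
split=> N nN.
  move=> eG; have eN := naive_to_cellK eG; exists (naive_to_cell N); split.
    split=> //; apply/is_cell_datum_naive_to_cell => //.
    by rewrite -eN; apply: trivial_groups_cell_to_naive.
  by move=> D [_ <-]; rewrite cell_to_naiveK.
move=> G1; exists (naive_to_cell N); split.
  split; first exact/is_cell_datum_naive_to_cell.
  exact: cell_to_naive_eq_upto_groups.
by move=> D [_ /naive_to_cell_eq_upto_groups <-]; rewrite cell_to_naiveK.
Qed.
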